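(* Let $n,d\ge1$ and let $U_1,\ldots,U_d$ be linear subspaces of $\mathbb{C}^n$. Let $f\in\otimes_{j=1}^d\mathbb{C}^n$. If for every $j\in\{1,\ldots,d\}$ and every $\boldsymbol{x}\in\{1,\ldots,n\}^{d-1}$ the probe $f_j(\boldsymbol{x})$ lies in $U_j$, then $f\in\otimes_{j=1}^dU_j$.
   Context: The space $\otimes_{j=1}^d\mathbb{C}^n$ is identified with the set of complex-valued functions on $\{1,\ldots,n\}^d$ (a pure tensor $u_1\otimes\cdots\otimes u_d$ corresponds to $(x_1,\ldots,x_d)\mapsto u_1(x_1)\cdots u_d(x_d)$), and $\otimes_{j=1}^dU_j$ is regarded as a linear subspace of it. For $\boldsymbol{x}=(x_1,\ldots,x_{d-1})\in\{1,\ldots,n\}^{d-1}$ the $j$-th probe of $f$ at $\boldsymbol{x}$ is the vector in $\mathbb{C}^n$ obtained by freezing all variables except the $j$-th: $$f_j(\boldsymbol{x})=f(x_1,\ldots,x_{j-1},\,\cdot\,,x_j,\ldots,x_{d-1}).$$ *)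

(* Defs.v *)
From HB Require Import structures.
From mathcomp Require Import all_boot all_order all_algebra.
From mathcomp Require Import reals complex.

Set Implicit Arguments.
Unset Strict Implicit.
Unset Printing Implicit Defensive.

Import GRing.Theory.
Local Open Scope ring_scope.

(* Scalars are [F^o] so that the functions on [{1, ..., n}^d] form a vector
   space over [F] itself; for [F = R[i]] the bare type also carries an
   [R]-linear structure. *)
Notation tensor F n d := {ffun {ffun 'I_d -> 'I_n} -> F^o}.

Section Tensor.
Variables (F : fieldType) (n d : nat).

Definition pure_tensor (u : 'I_d -> 'rV[F]_n) : tensor F n d :=
  [ffun x : {ffun 'I_d -> 'I_n} => \prod_(j < d) u j 0 (x j)].

(* The point (x_1, ..., x_{j-1}, t, x_j, ..., x_{d-1}). *)
Definition insert_coord (j : 'I_d) (x : {ffun 'I_d.-1 -> 'I_n}) (t : 'I_n) :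
    {ffun 'I_d -> 'I_n} :=
  [ffun i => if unlift j i is Some k then x k else t].

Definition probe (f : tensor F n d) (j : 'I_d) (x : {ffun 'I_d.-1 -> 'I_n}) :
    'rV[F]_n :=
  \row_(t < n) f (insert_coord j x t).

(* The linear span of the pure tensors with j-th factor in [U j]; [span] only
   takes finite sequences, hence the existential over finite families. *)
Definition in_tensor_subspace (U : 'I_d -> {vspace 'rV[F]_n})
    (f : tensor F n d) : Prop :=
  exists2 s : seq (tensor F n d),
    {in s, forall g, exists2 u : 'I_d -> 'rV[F]_n,
       (forall j, u j \in U j) & g = pure_tensor u} &
    f \in <<s>>%VS.

End Tensor.

(* Main.v *)
Require Import Defs.
From HB Require Import structures.
From mathcomp Require Import all_boot all_order all_algebra.
From mathcomp Require Import reals complex.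

Set Implicit Arguments.
Unset Strict Implicit.
Unset Printing Implicit Defensive.

Import GRing.Theory.
Local Open Scope ring_scope.

(** Let [T_j] be the linear operator on tensors that projects every fibre in
    direction [j] onto [U j], written [map_factor (projv (U j)) j].  The
    hypothesis on the probes makes [f] a fixed point of every [T_j]
    ([map_factor_projv_id]).  On the other hand [T_j] maps the pure tensor of
    [u] to the pure tensor in which [u j] is replaced by its projection onto
    [U j] ([map_factor_pure_tensor]).  Hence, if [f] is a combination of pure
    tensors, applying [T_j] gives back [f] as a combination of pure tensors
    whose [j]-th factors lie in [U j] and whose other factors are unchanged
    ([in_tensor_subspace_refine]).  Starting from the expansion of [f] in the
    canonical basis, where the factors are unrestricted
    ([in_tensor_subspace_full]), and treating the indices [j] one after the
    other, all the factors are brought into the given subspaces. *)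

Section ProbeTheory.
Variables (F : fieldType) (n d : nat).
Implicit Types (f : tensor F n d) (u : 'I_d -> 'rV[F]_n).
Implicit Types (U V : 'I_d -> {vspace 'rV[F]_n}) (x : {ffun 'I_d -> 'I_n}).

Definition remove_coord (j : 'I_d) x : {ffun 'I_d.-1 -> 'I_n} :=
  [ffun k => x (lift j k)].

Lemma remove_coordK j x : insert_coord j (remove_coord j x) (x j) = x.
Proof.
by apply/ffunP => i; rewrite !ffunE; case: unliftP => [k|] ->; rewrite ?ffunE.
Qed.

Lemma probe_remove_coord f j x : probe f j (remove_coord j x) 0 (x j) = f x.
Proof. by rewrite mxE remove_coordK. Qed.

Lemma pure_tensorE u j x :
  pure_tensor u x =
  (\prod_(k < d.-1) u (lift j k) 0 (x (lift j k))) * u j 0 (x j).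
Proof.
case: d u j x => [|d'] u j x; first by case: j.
by rewrite ffunE (bigD1_ord j) //= mulrC.
Qed.

Lemma probe_pure_tensor u j (y : {ffun 'I_d.-1 -> 'I_n}) :
  probe (pure_tensor u) j y = (\prod_(k < d.-1) u (lift j k) 0 (y k)) *: u j.
Proof.
apply/rowP => t; rewrite !mxE (pure_tensorE u j) ffunE unlift_none.
by congr (_ * _); apply: eq_bigr => k _; rewrite ffunE liftK.
Qed.

(** The operator [id (x) .. (x) pi (x) .. (x) id], with the endomorphism [pi]
    in position [j]. *)
Definition map_factor (pi : 'End('rV[F]_n)) (j : 'I_d) f : tensor F n d :=
  [ffun x => pi (probe f j (remove_coord j x)) 0 (x j)].

Lemma map_factor_is_linear pi j : linear (map_factor pi j).
Proof.
move=> a f g; apply/ffunP => x; rewrite !ffunE.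
have -> : probe (a *: f + g) j (remove_coord j x) =
    a *: probe f j (remove_coord j x) + probe g j (remove_coord j x).
  by apply/rowP => t; rewrite !mxE !ffunE.
by rewrite linearP !mxE.
Qed.

HB.instance Definition _ pi j :=
  GRing.isLinear.Build F (tensor F n d) (tensor F n d) _ (map_factor pi j)
    (map_factor_is_linear pi j).

Definition set_factor u j (v : 'rV[F]_n) : 'I_d -> 'rV[F]_n :=
  fun i => if i == j then v else u i.

(** In direction [j], every probe of the pure tensor of [u] is a multiple of
    [u j], so [pi] acts on it through [pi (u j)]. *)
Lemma map_factor_pure_tensor pi j u :
  map_factor pi j (pure_tensor u) = pure_tensor (set_factor u j (pi (u j))).
Proof.
apply/ffunP => x; rewrite (pure_tensorE _ j) ffunE probe_pure_tensor linearZ.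
rewrite mxE /set_factor eqxx; congr (_ * _); apply: eq_bigr => k _.
by rewrite ffunE eq_sym (negPf (neq_lift _ _)).
Qed.

(** Every value of [f] is an entry of one of its probes in direction [j], and
    [projv (U j)] fixes these probes. *)
Lemma map_factor_projv_id U j f :
  (forall y, probe f j y \in U j) -> map_factor (projv (U j)) j f = f.
Proof.
move=> fU; apply/ffunP => x.
by rewrite ffunE projv_id ?probe_remove_coord.
Qed.

Lemma in_tensor_subspaceS U V f :
  (forall j, U j <= V j)%VS -> in_tensor_subspace U f -> in_tensor_subspace V f.
Proof.
move=> sUV [s sP fs]; exists s => // g /sP[u uU ->].
by exists u => // j; apply: subvP (sUV j) _ (uU j).
Qed.

(** The canonical basis consists of the pure tensors of unit vectors. *)
Lemma in_tensor_subspace_full f : in_tensor_subspace (fun=> fullv) f.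
Proof.
pose e (x : {ffun 'I_d -> 'I_n}) : tensor F n d :=
  pure_tensor (fun j => delta_mx 0 (x j)).
exists [seq e x | x : {ffun 'I_d -> 'I_n}].
  move=> _ /mapP[x _ ->]; exists (fun j => delta_mx 0 (x j)) => // j.
  exact: memvf.
have -> : f = \sum_x f x *: e x.
  apply/ffunP => y; rewrite sum_ffunE (bigD1 y) //= big1 ?addr0.
    rewrite !ffunE big1 ?mulr1 //; first exact/esym/mulr1.
    by move=> j _; rewrite mxE !eqxx.
  move=> x neq_xy; have [j neq_j]: exists j, y j != x j.
    apply/existsP; rewrite -negb_forall; apply: contra neq_xy => /forallP eq_yx.
    by apply/eqP/ffunP => j; rewrite (eqP (eq_yx j)).
  by rewrite !ffunE (bigD1 j) //= mxE (negPf neq_j) andbF mul0r; exact: mulr0.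
by apply: memv_suml => x _; apply/memvZ/memv_span/map_f; rewrite mem_enum.
Qed.

(** The image of the spanning family of [f] under the operator that projects
    factor [j] onto [U j] spans the image of [f], which is [f] itself. *)
Lemma in_tensor_subspace_refine U V j f :
    (forall y, probe f j y \in U j) -> in_tensor_subspace V f ->
  in_tensor_subspace (fun i => if i == j then U i else V i) f.
Proof.
move=> fU [s sP fs]; pose T := linfun (map_factor (projv (U j)) j).
exists (map T s).
  move=> _ /mapP[_ /sP[u uV ->] ->]; rewrite lfunE /= map_factor_pure_tensor.
  exists (set_factor u j (projv (U j) (u j))) => // i; rewrite /set_factor.
  by case: eqP => [->|//]; exact: memv_proj.
have <- : T f = f by rewrite lfunE /= map_factor_projv_id.
by rewrite -limg_span memv_img.
Qed.

Lemma in_tensor_subspace_of_probes U f :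
  (forall j y, probe f j y \in U j) -> in_tensor_subspace U f.
Proof.
move=> fU.
have partial (r : seq 'I_d) :
    in_tensor_subspace (fun j => if j \in r then U j else fullv) f.
  elim: r => [|j r IHr]; first exact: in_tensor_subspace_full.
  apply: in_tensor_subspaceS (in_tensor_subspace_refine (fU j) IHr) => i.
  by rewrite inE; case: (i == j).
apply: in_tensor_subspaceS (partial (enum 'I_d)) => j.
by rewrite mem_enum.
Qed.

End ProbeTheory.

Theorem theorem3p1 (R : realType) (n d : nat) (hn : (1 <= n)%N) (hd : (1 <= d)%N)
    (U : 'I_d -> {vspace 'rV[R[i]]_n}) (f : tensor R[i] n d)
    (hf : forall (j : 'I_d) (x : {ffun 'I_d.-1 -> 'I_n}), probe f j x \in U j) :
  in_tensor_subspace U f.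
Proof. exact: in_tensor_subspace_of_probes. Qed.
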